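(* Let $G$ be a connected graph of order $n\ge 3$ and size $m$ having diameter $2$. Let $\sigma$ be the number of distance Laplacian eigenvalues of $G$ which are greater than or equal to $\frac{2W(G)}{n}$, and let $t$ be the number of Laplacian eigenvalues of $G$ which are greater than or equal to $\frac{2m}{n}$, where $1\le \sigma\le n-2$ and $1\le t\le n-2$. Then $$LE(G)-2\Big(\frac{2m}{n}-2(n-1)+2t\Big)\leq DLE(G)\le LE(G)+4\Big(\sigma-\frac{m}{n}\Big).$$
   Context: All graphs are simple and finite. For a connected graph $G$ with $n$ vertices and $m$ edges: $d_{uv}$ is the length of a shortest path between $u$ and $v$; the transmission of $v$ is $Tr_G(v)=\sum_{u} d_{uv}$; the Wiener index is $W(G)=\frac12\sum_v Tr_G(v)$. The distance Laplacian matrix is $D^L(G)=Tr(G)-D(G)$, where $D(G)=(d_{uv})$ and $Tr(G)$ is the diagonal matrix of transmissions; its eigenvalues $\rho_1^L\ge\dots\ge\rho_n^L$ (with multiplicity) are the distance Laplacian eigenvalues, and $DLE(G)=\sum_{i=1}^n\left|\rho_i^L-\frac{2W(G)}{n}\right|$. The Laplacian matrix is $L(G)=Deg(G)-A(G)$ (diagonal degree matrix minus adjacency matrix), with eigenvalues $\mu_1\ge\dots\ge\mu_n=0$ (with multiplicity), and $LE(G)=\sum_{i=1}^n\left|\mu_i-\frac{2m}{n}\right|$. Eigenvalues are counted with multiplicity. *)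

(* Defs.v *)
From HB Require Import structures.
From mathcomp Require Import all_boot all_order all_algebra polyrcf.

Set Implicit Arguments.
Unset Strict Implicit.
Unset Printing Implicit Defensive.

Import Order.TTheory GRing.Theory Num.Theory.
Local Open Scope ring_scope.

Section Graph.
Variables (T : finType) (e : rel T).

Definition simple_graph : Prop := symmetric e /\ irreflexive e.

Definition connected_graph : Prop := forall u v : T, connect e u v.

Definition edges : {set {set T}} :=
  [set [set p.1; p.2] | p in [set p : T * T | e p.1 p.2]].

Definition degree (u : T) : nat := #|[set v | e u v]|.

Definition has_path (u v : T) (k : nat) : bool :=
  [exists p : k.-tuple T, [&& path e u p, uniq (u :: p) & last u p == v]].

(* A path in T has length less than #|T|, so searching the lengths
   0, ..., #|T|.-1 is exhaustive; the result is the junk value #|T| when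
   u and v lie in different components. *)
Definition gdist (u v : T) : nat := find (has_path u v) (iota 0 #|T|).

Definition diameter : nat := (\max_u \max_v gdist u v)%N.

Definition transmission (v : T) : nat := (\sum_u gdist u v)%N.

End Graph.

Section Spectrum.
Variable R : rcfType.

(* The eigenvalues in R, in nonincreasing order, each repeated according to
   its multiplicity as a root of the characteristic polynomial. [rootsR p] is
   the increasing list of the distinct roots of p in R. *)
Definition eigenvalues (n : nat) (A : 'M[R]_n) : seq R :=
  let p := char_poly A in
  flatten [seq nseq (mup x p) x | x <- rev (rootsR p)].

Variables (T : finType) (e : rel T).

(* The vertex with index i is [enum_val i]. *)
Definition adjacency_mx : 'M[R]_#|T| :=
  \matrix_(i, j) (e (enum_val i) (enum_val j))%:R.

Definition degree_mx : 'M[R]_#|T| :=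
  diag_mx (\row_i (degree e (enum_val i))%:R).

Definition laplacian : 'M[R]_#|T| := degree_mx - adjacency_mx.

Definition distance_mx : 'M[R]_#|T| :=
  \matrix_(i, j) (gdist e (enum_val i) (enum_val j))%:R.

Definition transmission_mx : 'M[R]_#|T| :=
  diag_mx (\row_i (transmission e (enum_val i))%:R).

Definition dist_laplacian : 'M[R]_#|T| := transmission_mx - distance_mx.

Definition wiener : R := 2^-1 * \sum_v (transmission e v)%:R.

Definition laplacian_energy : R :=
  \sum_(x <- eigenvalues laplacian) `|x - 2 * #|edges e|%:R / #|T|%:R|.

Definition dist_laplacian_energy : R :=
  \sum_(x <- eigenvalues dist_laplacian) `|x - 2 * wiener / #|T|%:R|.

End Spectrum.

(* Main.v *)
(* In diameter 2 one has d(u,v) = 2 - A(u,v) off the diagonal, hence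
   D^L = 2n I - L - 2J with J the all-ones matrix. Since J commutes with L and
   only acts on the constant vectors, the spectrum of D^L is 0 together with
   2n - mu, for mu in the spectrum of L minus one eigenvalue 0. Put a = 2m/n; then
   2W/n = 2(n-1) - a, so that DLE = 2(n-1) - a + sum |a + 2 - mu| and
   LE = a + sum |mu - a|, over the same n - 1 values mu. *)

Require Import Defs.
From mathcomp Require Import all_boot all_order all_algebra.
From mathcomp Require Import ring lra polyrcf complex.

Import Order.TTheory GRing.Theory Num.Theory.
Local Open Scope ring_scope.

(** * Characteristic polynomials: splitting, rank-one shifts, reflection *)

(** Both lists contain each [x] as often as its multiplicity as a root of the characteristic
    polynomial: [rootsR] has no repetition, so a single block of [eigenvalues] contributes to the
    count. *)
Lemma perm_eigenvalues (R : rcfType) (n : nat) (A : 'M[R]_n) (s : seq R) :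
  char_poly A = \prod_(x <- s) ('X - x%:P) -> perm_eq (eigenvalues A) s.
Proof.
move=> pE; rewrite /eigenvalues; set p := char_poly A in pE *.
have p0 : p != 0 by rewrite monic_neq0 ?char_poly_monic.
apply/allP => x _ /=; rewrite -(mu_prod_XsubC x s) -pE.
rewrite count_flatten -map_comp map_rev sumn_rev sumnE big_map.
under eq_bigr => y _ do rewrite /= count_nseq /=.
have rE : (x \in rootsR p) = root p x.
  by rewrite -(roots_on_rootsR p0) in_itv.
have rU : uniq (rootsR p) := uniq_roots _ _ _.
case: (boolP (x \in rootsR p)) => [xr|xNr].
  rewrite (bigD1_seq x) //= eqxx mul1n big1 ?addn0 // => y /negPf ->.
  by rewrite mul0n.
rewrite mupNroot -?rE // big1_seq // => y /= yr.
by case: eqP => [yx|]; rewrite ?mul0n // -yx yr in xNr.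
Qed.

(** Over the complex extension [R[i]] the matrix becomes hermitian, hence unitarily diagonalizable
    with real spectrum; injectivity of the embedding brings the factorization back to [R]. *)
Lemma char_poly_symmetric (R : rcfType) (n : nat) (A : 'M[R]_n) :
  A^T = A -> exists s : seq R, char_poly A = \prod_(x <- s) ('X - x%:P).
Proof.
move=> symA; pose f := real_complex R.
pose B := map_mx f A.
have Breal : B \is a mxOver Num.real.
  by apply/mxOverP => i j; rewrite mxE complex_real.
have Bsym : B \is hermitianmx _ false idfun.
  by apply/is_hermitianmxP; rewrite expr0 scale1r map_mx_id // /B map_trmx symA.
have Bherm := realsym_hermsym Bsym Breal.
have /orthomx_spectralP BE := hermitian_normalmx Bherm.
have /mxOverP dreal := hermitian_spectral_diag_real Bherm.
set d := spectral_diag B in BE dreal; set P := spectralmx B in BE.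
have PU : P \in unitmx by apply: spectral_unit.
exists [seq complex.Re (d 0 i) | i <- index_enum 'I_n].
apply: (@map_poly_inj _ _ f).
rewrite map_char_poly -/B rmorph_prod big_map.
(* Similarity invariance: conjugation by [P] commutes with forming [X - B], and the determinants of
   [P] and its inverse cancel. *)
have -> : char_poly B = char_poly (diag_mx d).
  rewrite {1}BE /char_poly; have PP : invmx P *m P = 1%:M by rewrite mulVmx.
  have -> : char_poly_mx (invmx P *m diag_mx d *m P)
      = map_mx polyC (invmx P) *m char_poly_mx (diag_mx d) *m map_mx polyC P.
    rewrite /char_poly_mx mulmxBr mulmxBl -!map_mxM; congr (_ - _).
    by rewrite scalar_mxC -mulmxA -map_mxM PP map_mx1 mulmx1.
  by rewrite !det_mulmx mulrAC -det_mulmx -map_mxM PP map_mx1 det1 mul1r.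
rewrite char_poly_trig ?diag_mx_is_trig //.
apply: eq_bigr => i _.
by rewrite rmorphB /= map_polyX map_polyC /= mxE eqxx mulr1n RRe_real.
Qed.

(** The all-[c] matrix is the rank-one product [u *m v]. The determinant of the bordered matrix [B]
    is evaluated by two block eliminations, one per diagonal block; the factor [y] avoids dividing
    in an integral domain. *)
Lemma det_scalar_add_const (R : idomainType) (n : nat) (y c : R) :
  y * \det (y%:M + const_mx c : 'M_n) = (y + c * n%:R) * y ^+ n.
Proof.
pose u : 'cV[R]_n := const_mx 1; pose v : 'rV[R]_n := const_mx c.
pose B : 'M_(1 + n) := block_mx 1%:M v (- u) y%:M.
have detB : \det B = \det (y%:M + const_mx c : 'M_n).
  have : \det (B *m block_mx 1%:M (- v) 0 1%:M) = \det (y%:M + const_mx c : 'M_n).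
    rewrite mulmx_block !mulmx0 !mulmx1 !addr0 mul1mx addNr.
    rewrite det_lblock det1 mul1r; congr (\det _).
    rewrite mulNmx mulmxN opprK addrC; congr (_ + _).
    by apply/matrixP => i j; rewrite !mxE big_ord1 !mxE mul1r.
  by rewrite det_mulmx det_ublock !det1 !mulr1.
have : \det (B *m block_mx y%:M 0 u 1%:M) = (y + c * n%:R) * y ^+ n.
  rewrite mulmx_block !mulmx0 !mulmx1 !add0r !mul1mx.
  rewrite mul_mx_scalar mul_scalar_mx scalerN addNr det_ublock det_scalar.
  congr (_ * _); rewrite det_mx11 !mxE; congr (_ + _).
  under eq_bigr do rewrite !mxE mulr1.
  by rewrite sumr_const card_ord mulr_natr.
by rewrite det_mulmx det_lblock det_scalar1 det1 mulr1 detB mulrC => <-.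
Qed.

(** With J the all-ones matrix, L J = 0 gives y (y I + L + c J) = (y I + L)(y I + c J). Taking
    determinants leaves a common factor [y ^+ n], which is cancelled. *)
Lemma det_add_const (R : idomainType) (n : nat) (y c : R) (L : 'M[R]_n) :
  y != 0 -> L *m (const_mx 1 : 'M_n) = 0 ->
  y * \det (y%:M + L + const_mx c) = (y + c * n%:R) * \det (y%:M + L).
Proof.
move=> y0 L1; apply: (mulfI (expf_neq0 n y0)).
rewrite mulrCA -detZ.
have -> : y *: (y%:M + L + const_mx c) = (y%:M + L) *m (y%:M + const_mx c).
  have -> : const_mx c = c *: (const_mx 1 : 'M_n).
    by apply/matrixP => i j; rewrite !mxE mulr1.
  by rewrite mulmxDr mul_mx_scalar -scalemxAr mulmxDl L1 addr0 mul_scalar_mx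
    scalerDr !scalerA (mulrC c).
by rewrite det_mulmx mulrCA det_scalar_add_const mulrCA mulrA mulrC mulrA.
Qed.

(** Adding a constant matrix to a matrix with all row sums [a] trades its eigenvalue [a] for
    [a + c * n] and keeps the others. This is [det_add_const] over polynomials with y = X - a and L
    = a I - A. *)
Lemma char_poly_add_const (R : idomainType) (n : nat) (A : 'M[R]_n) (a c : R) :
  A *m (const_mx 1 : 'M_n) = const_mx a ->
  ('X - a%:P) * char_poly (A + const_mx c)
  = ('X - (a + c * n%:R)%:P) * char_poly A.
Proof.
move=> A1.
have := @det_add_const _ n ('X - a%:P) (- c%:P) (a%:P%:M - map_mx polyC A).
have -> : ('X - a%:P)%:M + (a%:P%:M - map_mx polyC A) = char_poly_mx A.
  by rewrite /char_poly_mx raddfB addrA subrK.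
have -> : char_poly_mx A + const_mx (- c%:P) = char_poly_mx (A + const_mx c).
  by apply/matrixP => i j; rewrite !mxE polyCD opprD addrA.
move=> ->; rewrite ?polyXsubC_eq0 //.
  by rewrite polyCD polyCM polyC_natr opprD mulNr addrA.
rewrite mulmxBl mul_scalar_mx.
have -> : (const_mx 1 : 'M[{poly R}]_n) = map_mx polyC (const_mx 1).
  by rewrite map_const_mx.
rewrite -map_mxM A1 -map_mxZ; apply/matrixP => i j.
by rewrite !mxE mulr1 subrr.
Qed.

Lemma char_poly_scalar_sub (R : idomainType) (n : nat) (A : 'M[R]_n) (a : R)
    (s : seq R) :
  char_poly A = \prod_(x <- s) ('X - x%:P) ->
  char_poly (a%:M - A) = \prod_(x <- s) ('X - (a - x)%:P).
Proof.
move=> AE.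
have size_s : size s = n.
  by apply/eq_add_S; rewrite -(size_prod_XsubC s id) -AE size_char_poly.
(* Since X - (a I - A) = -((a - X) - A), the variable is replaced by a - X at the cost of one sign
   per row, later distributed one per root. *)
have -> : char_poly (a%:M - A) = (-1) ^+ n * (char_poly A \Po (a%:P - 'X)).
  rewrite /char_poly -det_map_mx /= -detZ; congr (\det _).
  apply/matrixP => i j; rewrite !mxE comp_polyB comp_polyC polyCB.
  by case: (i == j); rewrite ?mulr1n ?mulr0n ?comp_polyX ?comp_poly0; ring.
rewrite AE rmorph_prod /= -size_s.
have -> : (-1 : {poly R}) ^+ size s = \prod_(x <- s) -1.
  by rewrite big_const_seq count_predT iter_mulr_1.
rewrite -big_split /=.
apply: eq_bigr => x _.
by rewrite comp_polyB comp_polyX comp_polyC polyCB; ring.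
Qed.

(** * Degrees, distances and transmissions in diameter 2 *)

(** Handshake lemma: the ordered adjacent pairs are grouped by their underlying edge, and each fibre
    consists of its two orientations, distinct by irreflexivity. *)
Lemma sum_degree (T : finType) (e : rel T) :
  simple_graph e -> (\sum_u degree e u = 2 * #|edges e|)%N.
Proof.
move=> [sym_e irr_e].
under eq_bigr => u _ do rewrite /degree -sum1_card.
rewrite pair_big_dep /=.
rewrite (eq_bigl (mem [set p : T * T | e p.1 p.2])) => [|p]; last first.
  by rewrite !inE.
rewrite (partition_big_imset (fun p : T * T => [set p.1; p.2])) /= -/(edges e).
rewrite mulnC -sum_nat_const; apply: eq_bigr => E.
case/imsetP=> -[u v]; rewrite inE /= => euv ->.
rewrite sum1_card -[RHS](_ : #|[set (u, v); (v, u)]| = 2%N); last first.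
  rewrite cards2; case: eqP => // -[uv _].
  by rewrite uv irr_e in euv.
apply: eq_card => -[x y]; rewrite !inE /= !xpair_eqE.
apply/andP/orP => [[]|[]/andP[/eqP-> /eqP->]]; last 2 first.
- by rewrite inE /= euv eqxx.
- by rewrite inE /= sym_e euv setUC eqxx.
rewrite inE /= => exy /eqP xyE.
have : x \in [set u; v] by rewrite -xyE set21.
have : y \in [set u; v] by rewrite -xyE set22.
rewrite !inE => /orP[]/eqP yE /orP[]/eqP xE; rewrite xE yE ?eqxx; auto;
  by rewrite xE yE irr_e in exy.
Qed.

Section DiameterTwo.
Variables (T : finType) (e : rel T).
Hypotheses (simple_e : simple_graph e) (diam_e : diameter e = 2%N)
  (card_T : (2 < #|T|)%N).

Lemma gdist_diameter2 u v : gdist e u v = (if u == v then 0 else 2 - e u v)%N.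
Proof.
have [sym_e irr_e] := simple_e.
have le2 : (gdist e u v <= 2)%N.
  rewrite -diam_e; apply: leq_trans (leq_bigmax u).
  exact: (leq_bigmax (F := fun w => gdist e u w)).
have path0 : has_path e u v 0 = (u == v).
  apply/existsP/idP => [[p]|uv]; first by rewrite (tuple0 p).
  by exists [tuple]; rewrite /= uv.
have path1 : has_path e u v 1 = e u v.
  apply/existsP/idP => [[p]|euv].
    case/tupleP: p => w p; rewrite (tuple0 p) /= andbT.
    by case/and3P => euw _ /eqP <-.
  exists [tuple v]; rewrite /= euv eqxx !andbT inE.
  by apply: contraTneq euv => ->; rewrite irr_e.
(* As [#|T|] is at least 3, the search list begins with 0, 1, 2. Once lengths 0 and 1 fail, the
   bound [le2] excludes every result but 2. *)
move: le2; rewrite /gdist -(subnKC card_T) /= path0 path1.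
by case: eqP => // _; case: (e u v) => //=; case: has_path.
Qed.

(** Every vertex other than [v] contributes 2 in total, as 1 + 1 if adjacent to [v] and 2 + 0 if
    not; [v] itself contributes nothing. *)
Lemma transmission_diameter2 v :
  (transmission e v + degree e v = 2 * (#|T| - 1))%N.
Proof.
have [sym_e irr_e] := simple_e.
have -> : degree e v = (\sum_u e u v)%N.
  rewrite /degree -sum1_card big_mkcond /=; apply: eq_bigr => u _.
  by rewrite inE sym_e; case: (e u v).
rewrite /transmission -big_split (bigD1 v) //= gdist_diameter2 eqxx irr_e add0n.
rewrite (eq_bigr (fun=> 2%N)) => [|u /negPf uv]; last first.
  by rewrite gdist_diameter2 uv; case: (e u v).
rewrite sum_nat_const mulnC subn1; congr (_ * _)%N.
by rewrite (cardC1 v).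
Qed.

Lemma dist_laplacian_diameter2 (R : rcfType) :
  dist_laplacian R e
  = (2 * #|T|%:R)%:M - laplacian R e + const_mx (- 2).
Proof.
have [sym_e irr_e] := simple_e.
apply/matrixP => i j; rewrite !mxE gdist_diameter2 (inj_eq enum_val_inj).
have [<-|_] := eqVneq i j; last first.
  by case: (e _ _); rewrite ?subn0 ?subn1 !mulr0n /=; lra.
rewrite irr_e !mulr1n !mulr0n.
have /(congr1 (fun k => k%:R : R)) := transmission_diameter2 (enum_val i).
rewrite natrD natrM natrB ?(ltnW (ltnW card_T)) // => TE.
by lra.
Qed.

(** The transmission identity is summed over all vertices; this ties the two means 2W/n and 2m/n
    together. *)
Lemma wiener_diameter2 (R : rcfType) :
  2 * wiener R e + 2 * #|edges e|%:R = 2 * #|T|%:R * (#|T|%:R - 1).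
Proof.
rewrite /wiener mulrA mulfV ?pnatr_eq0 // mul1r -natr_sum -natrM -sum_degree //.
rewrite -natrD -big_split /=; under eq_bigr do rewrite transmission_diameter2.
rewrite sum_nat_const mulnCA mulnA !natrM natrB //.
exact: ltnW (ltnW card_T).
Qed.

End DiameterTwo.

(** * Spectra of the two Laplacians and comparison of their energies *)

Lemma laplacian_sym (R : rcfType) (T : finType) (e : rel T) :
  symmetric e -> (laplacian R e)^T = laplacian R e.
Proof.
move=> sym_e; rewrite /laplacian raddfB /= tr_diag_mx; congr (_ - _).
by apply/matrixP => i j; rewrite !mxE sym_e.
Qed.

(** Rows of the Laplacian sum to zero. The free width [p] covers both the constant vector and the
    all-ones matrix. *)
Lemma laplacian_const (R : rcfType) (T : finType) (e : rel T) (p : nat) (c : R) :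
  laplacian R e *m (const_mx c : 'M_(_, p)) = 0.
Proof.
apply/matrixP => i j; rewrite mulmxBl mul_diag_mx !mxE.
under eq_bigr do rewrite !mxE.
rewrite -mulr_suml -natr_sum -mulrBl.
have -> : degree e (enum_val i) = (\sum_(k < #|T|) e (enum_val i) (enum_val k))%N.
  rewrite -(big_enum_val (fun v => e (enum_val i) v : nat)) /=.
  rewrite /degree -sum1_card big_mkcond; apply: eq_bigr => v _.
  by rewrite inE; case: (e _ _).
by rewrite subrr mul0r.
Qed.

(** One eigenvalue 0, that of the constant vector, is split off. The factorization is kept beside
    the list because the distance Laplacian spectrum is derived from it. *)
Lemma eigenvalues_laplacian (R : rcfType) (T : finType) (e : rel T) :
  symmetric e -> (0 < #|T|)%N ->
  exists s : seq R, [/\ (size s).+1 = #|T|,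
    perm_eq (eigenvalues (laplacian R e)) (0 :: s) &
    char_poly (laplacian R e) = \prod_(x <- 0 :: s) ('X - x%:P)].
Proof.
move=> sym_e T_gt0.
have [s sE] := char_poly_symmetric _ _ _ (laplacian_sym R _ _ sym_e).
have s0 : 0 \in s.
  rewrite -root_prod_XsubC -sE -eigenvalue_root_char.
  apply/eigenvalueP; exists (const_mx 1).
    (* Eigenvectors are row vectors here, so symmetry is used to pass to the column version. *)
    rewrite scale0r -[LHS]trmxK trmx_mul laplacian_sym // trmx_const.
    by rewrite laplacian_const trmx0.
  apply/eqP => /matrixP /(_ 0 (Ordinal T_gt0)) /eqP.
  by rewrite !mxE oner_eq0.
have sE' : char_poly (laplacian R e) = \prod_(x <- 0 :: rem 0 s) ('X - x%:P).
  by rewrite sE; apply: perm_big; apply: perm_to_rem.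
exists (rem 0 s); split=> //; last exact: perm_eigenvalues.
by apply/eq_add_S; rewrite -(size_char_poly (laplacian R e)) sE' size_prod_XsubC.
Qed.

Lemma eigenvalues_dist_laplacian (R : rcfType) (T : finType) (e : rel T)
    (s : seq R) :
  simple_graph e -> diameter e = 2%N -> (2 < #|T|)%N ->
  char_poly (laplacian R e) = \prod_(x <- 0 :: s) ('X - x%:P) ->
  perm_eq (eigenvalues (dist_laplacian R e))
    (0 :: [seq 2 * #|T|%:R - x | x <- s]).
Proof.
move=> simple_e diam_e T_gt2 sE; apply: perm_eigenvalues.
rewrite dist_laplacian_diameter2 //; set a := 2 * #|T|%:R.
have B1 : (a%:M - laplacian R e) *m (const_mx 1 : 'M_#|T|) = const_mx a.
  rewrite mulmxBl laplacian_const subr0 mul_scalar_mx.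
  by apply/matrixP => i j; rewrite !mxE mulr1.
(* The row sums are a = 2n, so adding -2J sends the eigenvalue [a], the image of 0, to a - 2n = 0;
   the factor X - a then cancels. *)
have := char_poly_add_const _ _ _ _ (- 2) B1.
rewrite (char_poly_scalar_sub _ _ _ a _ sE) big_cons subr0 mulNr subrr mulrCA.
have aX : 'X - a%:P != 0 by rewrite polyXsubC_eq0.
by move/(mulfI aX) ->; rewrite big_cons big_map.
Qed.

(* Termwise: |a + 2 - x| - |x - a| is at most 2 where counted and -2 elsewhere. *)
Lemma sum_norm_shift_le (R : realFieldType) (a : R) (s : seq R) :
  \sum_(x <- s) `|a + 2 - x|
    <= \sum_(x <- s) `|x - a| + 4 * (count (fun x => x <= a + 2)%R s)%:R
       - 2 * (size s)%:R.
Proof.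
elim: s => [|x s IHs]; first by rewrite !big_nil /= !mulr0 addr0 subr0.
rewrite !big_cons /= -[(size s).+1]addn1 !natrD.
suff : `|a + 2 - x| <= `|x - a| + 4 * (x <= a + 2)%R%:R - 2 by lra.
have := ler_norm (x - a); have := ler_norm (a - x); rewrite (distrC a).
by move=> le1 le2; case: (lerP x (a + 2)) => xa /=; lra.
Qed.

(** Termwise, |a + 2 - x| - |x - a| is at least -2 where x >= a, and exactly 2 where x < a. *)
Lemma sum_norm_shift_ge (R : realFieldType) (a : R) (s : seq R) :
  \sum_(x <- s) `|x - a| + 2 * (size s)%:R
    - 4 * (count (fun x => a <= x)%R s)%:R
  <= \sum_(x <- s) `|a + 2 - x|.
Proof.
elim: s => [|x s IHs]; first by rewrite !big_nil /= !mulr0 addr0 subr0.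
rewrite !big_cons /= -[(size s).+1]addn1 !natrD.
suff : `|x - a| + 2 - 4 * (a <= x)%R%:R <= `|a + 2 - x| by lra.
have := ler_norm (a + 2 - x); have := ler_norm (- (a + 2 - x)); rewrite normrN.
by move=> le1 le2; case: (lerP a x) => xa /=; lra.
Qed.

Theorem theorem2p4 (R : rcfType) (T : finType) (e : rel T)
    (n m sigma t : nat)
    (simple_e : simple_graph e) (connected_e : connected_graph e)
    (diam_e : diameter e = 2%N)
    (def_n : n = #|T|) (n_ge3 : (3 <= n)%N)
    (def_m : m = #|edges e|)
    (def_sigma : sigma = count (fun x : R => 2 * wiener R e / n%:R <= x)
                               (eigenvalues (dist_laplacian R e)))
    (def_t : t = count (fun x : R => 2 * m%:R / n%:R <= x)
                       (eigenvalues (laplacian R e)))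
    (sigma_bounds : (1 <= sigma <= n - 2)%N)
    (t_bounds : (1 <= t <= n - 2)%N) :
  laplacian_energy R e
    - 2 * (2 * m%:R / n%:R - 2 * (n%:R - 1) + 2 * t%:R)
    <= dist_laplacian_energy R e
  /\ dist_laplacian_energy R e
    <= laplacian_energy R e + 4 * (sigma%:R - m%:R / n%:R).
Proof.
subst n m sigma t; have T_gt0 : (0 < #|T|)%N by apply: ltnW (ltnW n_ge3).
have [s [size_s Ls Lpoly]] := eigenvalues_laplacian R T e (proj1 simple_e) T_gt0.
have DLs := eigenvalues_dist_laplacian R T e s simple_e diam_e n_ge3 Lpoly.
rewrite /laplacian_energy /dist_laplacian_energy.
rewrite !(perm_big _ Ls) !(perm_big _ DLs) /= !big_cons big_map.
rewrite (permP Ls) (permP DLs) /= count_map /=.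
set N : R := #|T|%:R; set a : R := 2 * #|edges e|%:R / N.
set b : R := 2 * wiener R e / N.
have N_gt0 : 0 < N by rewrite ltr0n.
have a_ge0 : 0 <= a by rewrite !mulr_ge0 ?invr_ge0 ?ler0n.
have b_ge0 : 0 <= b.
  by rewrite !mulr_ge0 ?invr_ge0 ?ler0n // sumr_ge0.
have abE : b = 2 * (N - 1) - a.
  have := wiener_diameter2 T e simple_e diam_e n_ge3 R.
  rewrite -/N => WE; apply/eqP; rewrite eq_sym subr_eq -mulrDl WE.
  by apply/eqP; field; rewrite gt_eqF.
have sizeE : (size s)%:R = N - 1 :> R by rewrite /N -size_s -natr1 addrK.
have -> : \sum_(x <- s) `|2 * N - x - b| = \sum_(x <- s) `|a + 2 - x|.
  by apply: eq_bigr => x _; rewrite abE; congr (`|_|); ring.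
(* Because 2N - b = a + 2, the condition 2N - x >= b reads x <= a + 2. *)
have -> : count (preim (fun x => 2 * N - x) (fun x => b <= x)) s
    = count (fun x => x <= a + 2) s.
  by apply: eq_count => x /=; rewrite abE; apply/idP/idP; lra.
(* The eigenvalue 0 adds [a] to the Laplacian energy and [b] to the distance Laplacian energy. *)
rewrite !sub0r !normrN !ger0_norm // !natrD.
have := sum_norm_shift_le R a s; have := sum_norm_shift_ge R a s.
rewrite sizeE => lower upper.
have a2 : #|edges e|%:R / N = a / 2 by rewrite /a; field; rewrite gt_eqF.
(* These indicators record whether the eigenvalue 0 is itself counted in t or sigma; being
   nonnegative, they can only weaken the two bounds. *)
have da : 0 <= (a <= 0)%R%:R :> R by rewrite ler0n.
have db : 0 <= (b <= 0)%R%:R :> R by rewrite ler0n.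
by rewrite a2; split; lra.
Qed.
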